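(* There is no probability distribution on $\mathcal{M}_n$ which is absolutely continuous with respect to $\mathcal{U}(\mathcal{M}_n)$, has full support (i.e. its support is $\mathcal{M}_n$), and is invariant under every left translation $\mathbf{M}\mapsto\mathbf{T}\mathbf{M}$, where $\mathbf{T}$ runs over $\mathcal{M}_n$. The same holds true for right translations: there is no probability distribution on $\mathcal{M}_n$ which is absolutely continuous with respect to $\mathcal{U}(\mathcal{M}_n)$, has full support, and is invariant under every right translation $\mathbf{M}\mapsto\mathbf{M}\mathbf{T}$, where $\mathbf{T}$ runs over $\mathcal{M}_n$.
   Context: Here $n$ is a positive integer. A real $n\times n$ matrix is Markov if its entries are non-negative and each row sums to $1$. $\mathcal{M}_n$ denotes the set of all $n\times n$ Markov matrices; it is a compact convex polytope in $\mathbb{R}^{n^2}$, with $n(n-1)$ degrees of freedom if $n>1$, and a compact semigroup for the matrix product. The uniform distribution $\mathcal{U}(\mathcal{M}_n)$ on $\mathcal{M}_n$ is the normalized trace on $\mathcal{M}_n$ of the Lebesgue measure of $\mathbb{R}^{n^2}$, i.e. the probability measure obtained by normalizing the restriction to $\mathcal{M}_n$ of the $n(n-1)$-dimensional Hausdorff measure (equivalently, of the Lebesgue measure of the affine hull of $\mathcal{M}_n$). A probability distribution $\mu$ on $\mathcal{M}_n$ is invariant under a map $f:\mathcal{M}_n\to\mathcal{M}_n$ if the image measure of $\mu$ by $f$ is $\mu$.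
   Formalization: The formal theorem assumes n > 1; for n = 1 the claim fails, since the set of Markov matrices is the single point (1) and its Dirac mass is the uniform distribution, has full support and is invariant under the only translation, the identity. *)

(* Defs.v *)
From HB Require Import structures.
From mathcomp Require Import all_boot all_order all_algebra.
From mathcomp Require Import all_classical all_reals all_analysis.

Set Implicit Arguments.
Unset Strict Implicit.
Unset Printing Implicit Defensive.

Import Order.TTheory GRing.Theory Num.Theory.
Import numFieldNormedType.Exports.

Local Open Scope classical_set_scope.
Local Open Scope ring_scope.

Definition is_markov (R : realType) (n : nat) (M : 'M[R]_n) : bool :=
  [forall i, forall j, 0 <= M i j] && [forall i, \sum_j M i j == 1].

Record markov_matrix (R : realType) (n : nat) := Markov {
  markov_mx :> 'M[R]_n;
  markovP : is_markov markov_mx }.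

HB.instance Definition _ (R : realType) (n : nat) :=
  [isSub for @markov_mx R n].
HB.instance Definition _ (R : realType) (n : nat) :=
  [Choice of markov_matrix R n by <:].

(* The topology of [markov_matrix R n] is the one induced by ['M[R]_n]. *)
HB.instance Definition _ (R : realType) (n : nat) :=
  Topological.copy (markov_matrix R n) (initial_topology (@markov_mx R n)).

Lemma is_markov1 (R : realType) (n : nat) : is_markov (1%:M : 'M[R]_n).
Proof.
apply/andP; split; apply/forallP => i.
  by apply/forallP => j; rewrite mxE ler0n.
rewrite (bigD1 i) //= mxE eqxx big1 ?addr0 // => j ji.
by rewrite mxE eq_sym (negbTE ji).
Qed.

(* The library asks every measurable type to have a distinguished point. *)
HB.instance Definition _ (R : realType) (n : nat) :=
  isPointed.Build (markov_matrix R n) (Markov (is_markov1 R n)).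

Lemma is_markovM (R : realType) (n : nat) (A B : 'M[R]_n) :
  is_markov A -> is_markov B -> is_markov (A *m B).
Proof.
move=> /andP[/forallP A0 /forallP A1] /andP[/forallP B0 /forallP B1].
apply/andP; split; apply/forallP => i.
  apply/forallP => j; rewrite mxE; apply: sumr_ge0 => k _.
  by apply: mulr_ge0; [exact: (forallP (A0 i))|exact: (forallP (B0 k))].
under eq_bigr do rewrite mxE.
rewrite exchange_big /= -(eqP (A1 i)); apply/eqP/eq_bigr => k _.
by rewrite -mulr_sumr (eqP (B1 k)) mulr1.
Qed.

Definition markov_mul (R : realType) (n : nat) (A B : markov_matrix R n) :
  markov_matrix R n := Markov (is_markovM (markovP A) (markovP B)).

Definition left_translation (R : realType) (n : nat) (T : markov_matrix R n) :
  markov_matrix R n -> markov_matrix R n := fun M => markov_mul T M.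

Definition right_translation (R : realType) (n : nat) (T : markov_matrix R n) :
  markov_matrix R n -> markov_matrix R n := fun M => markov_mul M T.

(* The library norm on matrices is the sup norm, hence this definition. *)
Definition euclidean_dist (R : realType) (m n : nat) (A B : 'M[R]_(m, n)) : R :=
  Num.sqrt (\sum_i \sum_j (A i j - B i j) ^+ 2).

(* As a supremum in [\bar R], the diameter of the empty set is [-oo]. *)
Definition diam (R : realType) (m n : nat) (U : set 'M[R]_(m, n)) : \bar R :=
  ereal_sup [set (euclidean_dist A B)%:E | A in U & B in U].

(* The empty set weighs 0 even if d = 0, and 0 ^+ 0 = 1 for singletons, so that
   the 0-dimensional Hausdorff measure is the counting measure. *)
Definition diam_pow (R : realType) (m n d : nat) (U : set 'M[R]_(m, n)) :
    \bar R :=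
  if `[< U = set0 >] then 0%E else (diam U ^+ d)%E.

Definition hausdorff_premeasure (R : realType) (m n d : nat) (delta : R)
    (A : set 'M[R]_(m, n)) : \bar R :=
  ereal_inf [set (\sum_(0 <= k <oo) diam_pow d (F k))%E |
    F in [set F : (set 'M[R]_(m, n))^nat |
      A `<=` \bigcup_k F k /\ forall k, (diam (F k) <= delta%:E)%E]].

(* Without the customary factor depending only on d, which disappears on
   normalization. *)
Definition hausdorff_measure (R : realType) (m n d : nat)
    (A : set 'M[R]_(m, n)) : \bar R :=
  ereal_sup [set hausdorff_premeasure d delta A | delta in [set r : R | 0 < r]].

Definition markov_borel (R : realType) (n : nat) : Type :=
  g_sigma_algebraType (@open (markov_matrix R n)).

(* Normalized trace on Markov matrices of the Hausdorff measure of matrices in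
   dimension n (n - 1), the dimension of their affine hull. *)
Definition uniform_markov (R : realType) (n : nat)
    (A : set (markov_borel R n)) : \bar R :=
  (hausdorff_measure (n * n.-1) (@markov_mx R n @` A) /
   hausdorff_measure (n * n.-1) (range (@markov_mx R n)))%E.

Definition msupport (R : realType) (n : nat)
    (mu : probability (markov_borel R n) R) : set (markov_matrix R n) :=
  [set M | forall V : set (markov_matrix R n), open V -> V M -> (0 < mu V)%E].

Definition full_support (R : realType) (n : nat)
    (mu : probability (markov_borel R n) R) : Prop :=
  msupport mu = [set: markov_matrix R n].

Definition invariant_under (R : realType) (n : nat)
    (mu : probability (markov_borel R n) R)
    (f : markov_matrix R n -> markov_matrix R n) : Prop :=
  forall A : set (markov_borel R n), measurable A ->
    pushforward mu (f : markov_borel R n -> markov_borel R n) A = mu A.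

(* Main.v *)
(** Let [T] be the Markov matrix all of whose rows are the first basis vector.
    Both [T M] and [M T] have all their rows equal, so an invariant
    distribution does not charge the open set of the Markov matrices [M] with
    [M i j < M i' j], which contains the identity matrix when [i <> i'] and
    [j = i']. This contradicts full support. *)

Require Import Defs.
From mathcomp Require Import all_boot all_order all_algebra.
From mathcomp Require Import all_classical all_reals all_analysis.

Set Implicit Arguments.
Unset Strict Implicit.
Unset Printing Implicit Defensive.

Import Order.TTheory GRing.Theory Num.Theory.
Import numFieldNormedType.Exports.

Local Open Scope classical_set_scope.
Local Open Scope ring_scope.

Lemma continuous_markov_entry (R : realType) (n : nat) (i j : 'I_n) :
  continuous (fun M : markov_matrix R n => M i j).
Proof.
move=> M.
apply: (@continuous_comp _ _ _ (@markov_mx R n) (fun A : 'M[R]_n => A i j)).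
  exact: initial_continuous.
exact: coord_continuous.
Qed.

Lemma open_markov_entry_lt (R : realType) (n : nat) (i i' j : 'I_n) :
  open [set M : markov_matrix R n | M i j < M i' j].
Proof.
have -> : [set M : markov_matrix R n | M i j < M i' j] =
    (fun M : markov_matrix R n => M i' j - M i j) @^-1` [set x | 0 < x].
  by apply/seteqP; split => M /=; rewrite subr_gt0.
apply: open_comp; last exact: open_gt.
by move=> M _; apply: continuousB; exact: continuous_markov_entry.
Qed.

(** Equality of rows is all that left and right translation by [T] need to share, so [f] is kept
    abstract to serve both. *)
Lemma equal_rows_not_full_support (R : realType) (n : nat) (hn : (1 < n)%N)
    (f : markov_matrix R n -> markov_matrix R n)
    (mu : probability (markov_borel R n) R) :
  (forall M i i' j, f M i j = f M i' j) -> invariant_under mu f ->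
  ~ full_support mu.
Proof.
move=> fE muf mu_full.
pose i0 : 'I_n := Ordinal (ltnW hn); pose i1 : 'I_n := Ordinal hn.
(* At the identity this inequality reads [0 < 1], because [i1] and [i0] are distinct. *)
pose V := [set M : markov_matrix R n | M i1 i0 < M i0 i0].
have oV : open V by exact: open_markov_entry_lt.
have : msupport mu (Markov (is_markov1 R n)) by rewrite mu_full.
move=> /(_ V oV); rewrite /V /= !mxE eqxx ltr01 => /(_ isT).
have <- : pushforward mu (f : markov_borel R n -> markov_borel R n) V = mu V.
  by apply: muf; exact: sub_sigma_algebra.
(* Rows [i1] and [i0] of [f M] agree, so [f M] is never in [V]; hence [mu V] is 0, against
   [0 < mu V]. *)
rewrite /pushforward (_ : _ @^-1` _ = set0) ?measure0 ?ltxx//.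
by apply/seteqP; split => // M; rewrite /V /= (fE M i1 i0) ltxx.
Qed.

Definition const_row_mx (R : realType) (n : nat) (k : 'I_n) : 'M[R]_n :=
  \matrix_(i, j) (j == k)%:R.

Lemma is_markov_const_row (R : realType) (n : nat) (k : 'I_n) :
  is_markov (const_row_mx R k).
Proof.
apply/andP; split; apply/forallP => i.
  by apply/forallP => j; rewrite mxE ler0n.
rewrite (bigD1 k) //= mxE eqxx big1 ?addr0 // => j jk.
by rewrite mxE (negbTE jk).
Qed.

Lemma const_row_mul_rows (R : realType) (n : nat) (k : 'I_n) (M : 'M[R]_n)
    (i i' j : 'I_n) :
  (const_row_mx R k *m M) i j = (const_row_mx R k *m M) i' j.
Proof. by rewrite !mxE; apply: eq_bigr => l _; rewrite !mxE. Qed.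

(** Entry [(i, j)] of the product is the sum of row [i] of [M], which is 1, times [(j == k)%:R].
    Right translation by this matrix is thus a constant map. *)
Lemma markov_mul_const_row (R : realType) (n : nat) (k : 'I_n) (M : 'M[R]_n) :
  is_markov M -> M *m const_row_mx R k = const_row_mx R k.
Proof.
move=> /andP[_ /forallP M1]; apply/matrixP => i j; rewrite !mxE.
under eq_bigr do rewrite mxE.
by rewrite -mulr_suml (eqP (M1 i)) mul1r.
Qed.

(** The case [n = 1] is excluded: the identity is then the only Markov matrix, and its Dirac mass is
    the uniform distribution, with full support and invariant under all translations. *)
Theorem theorem1p4 (R : realType) (n : nat) (hn : (1 < n)%N) :
  (~ exists mu : probability (markov_borel R n) R,
      [/\ mu `<< @uniform_markov R n,
          full_support mu &
          forall T : markov_matrix R n, invariant_under mu (left_translation T)])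
  /\
  (~ exists mu : probability (markov_borel R n) R,
      [/\ mu `<< @uniform_markov R n,
          full_support mu &
          forall T : markov_matrix R n, invariant_under mu (right_translation T)]).
Proof.
(* Any column index would do; [ltnW hn] is read as [0 < n], which selects the first. *)
pose T := Markov (is_markov_const_row R (Ordinal (ltnW hn))).
split=> -[mu [_ mu_full /(_ T) muT]];
  apply: (equal_rows_not_full_support hn _ muT mu_full) => M i i' j /=.
- exact: const_row_mul_rows.
- by rewrite markov_mul_const_row ?markovP // !mxE.
Qed.
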